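(* Let $D_n=\sum_{k=0}^n\binom{n}{k}^2\binom{2k}{k}\binom{2(n-k)}{n-k}$ for $n\ge 0$. Then \[ \sum_{n\ge 1}\frac{64^n}{n^3D_nD_{n-1}}=\frac{56}{3}\zeta(3). \]
   Context: $\zeta$ denotes the Riemann zeta function. The numbers $D_n$ are called the Domb numbers. *)

(* Defs.v *)
From mathcomp Require Import all_boot all_order all_algebra.
From mathcomp Require Import classical_sets reals topology normedtype sequences exp.
Set Implicit Arguments.
Unset Strict Implicit.
Unset Printing Implicit Defensive.
Import GRing.Theory Num.Theory.
Import numFieldNormedType.Exports.

Definition domb (n : nat) : nat :=
  \sum_(0 <= k < n.+1) 'C(n, k) ^ 2 * 'C(k.*2, k) * 'C((n - k).*2, n - k).

(* The Riemann zeta function on the real half-line s > 1, where it is the sum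
   of its Dirichlet series; no analytic continuation, so the value is
   meaningless for s <= 1. *)
Definition zeta (R : realType) (s : R) : R :=
  limn (series (riemannR s)).

(* Main.v *)
Require Import Defs.
From mathcomp Require Import all_boot all_order all_algebra.
From mathcomp Require Import boolp classical_sets reals topology normedtype sequences exp.
From mathcomp Require Import ring lra.
Set Implicit Arguments.
Unset Strict Implicit.
Unset Printing Implicit Defensive.
Import Order.TTheory GRing.Theory Num.Theory.
Import numFieldNormedType.Exports.
Local Open Scope classical_set_scope.
Local Open Scope ring_scope.

(** Let
      R_n(t) = 4^n n!^2 (t-n+1/2)_n / (t(t-1)...(t-n))^3.
    The leading coefficients of R_n at its triple poles [t = k] are the summands
    of the Domb number D_n, so D_n and J_n = sum_{t = n+1/2, n+3/2, ...} R_n(t)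
    satisfy the same three-term recurrence, with one common
    creative-telescoping certificate.  The Casoratian is
      J_{n-1} D_n - J_n D_{n-1} = (3/8) 64^n / n^3,
    hence the series telescopes to (8/3)(J_0/D_0 - lim J_n/D_n).  Finally
    J_0 = sum 1/(i+1/2)^3 = 7 zeta(3), and J_n / D_n -> 0 since
    J_n <= 4^n J_0 while D_n >= n 4^(n-1). *)

Ltac solve_pos_neq0 := repeat (apply/andP; split); apply: lt0r_neq0; lra.

(** * The common recurrence *)

Section Recurrence.
Variable R : realFieldType.
Implicit Types (n k i M : nat) (t : R).

(** Middle coefficient of (n+1)^3 D_(n+1) - 2(2n+1)(5n^2+5n+2) D_n + 64 n^3 D_(n-1) = 0. For D_n /
    n!^2 the outer coefficients become (n+1)^5 and 64 n. *)
Definition domb_rec_mid n : R :=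
  2 * (2 * n%:R + 1) * (5 * n%:R ^+ 2 + 5 * n%:R + 2).

(* Found by solving the creative-telescoping equation with a cubic ansatz in
   [t]; used at integers [t] for D_n and at half-integers for J_n. *)
Definition wz_cert n t : R :=
  8 * t ^+ 3 - (24 + 36 * n%:R) * t ^+ 2
  + (22 + 74 * n%:R + 52 * n%:R ^+ 2) * t
  - (4 + 32 * n%:R + 52 * n%:R ^+ 2 + 24 * n%:R ^+ 3).

Definition sdomb_coef k : R := (k.*2)`!%:R / (k`!%:R) ^+ 4.

Lemma sdomb_coef0 : sdomb_coef 0 = 1.
Proof. by rewrite /sdomb_coef double0 fact0 expr1n divr1. Qed.

Lemma sdomb_coefS k :
  sdomb_coef k.+1 = 2 * (2 * k%:R + 1) / (k%:R + 1) ^+ 3 * sdomb_coef k.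
Proof.
rewrite /sdomb_coef doubleS !factS !natrM -!natr1 -mul2n natrM.
have k0 := ler0n R k.
have : (k`!%:R : R) != 0 by rewrite pnatr_eq0 -lt0n fact_gt0.
move: (k`!%:R : R) k0 => f; move: (k%:R : R) ((2*k)`!%:R : R) => a b a0 f0.
by field; rewrite f0 /=; solve_pos_neq0.
Qed.

Lemma sdomb_coef_gt0 k : 0 < sdomb_coef k.
Proof. by rewrite divr_gt0 ?exprn_gt0 // ltr0n fact_gt0. Qed.

(* D_n / n!^2 *)
Definition sdomb n : R := \sum_(k < n.+1) sdomb_coef k * sdomb_coef (n - k).

(** The increment in k of the right side is the summand, and the factor k^3 makes it vanish at k =
    0. The bound on k keeps every truncated subtraction exact. *)
Lemma sdomb_telescope n k : (k <= n.+1)%N ->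
  \sum_(i < k) ((n.+1%:R + 1) ^+ 5 * (sdomb_coef i * sdomb_coef (n.+2 - i))
    - domb_rec_mid n.+1 * (sdomb_coef i * sdomb_coef (n.+1 - i))
    + 64 * n.+1%:R * (sdomb_coef i * sdomb_coef (n - i)))
  = k%:R ^+ 3 * wz_cert n.+1 k%:R * (sdomb_coef k * sdomb_coef (n.+1 - k))
    / (n.+2%:R - k%:R) ^+ 3.
Proof.
elim: k => [|k IH] kn; first by rewrite big_ord0 expr0n /= !mul0r.
rewrite big_ord_recr /= IH ?(ltnW kn) //.
have -> : n = (k + (n - k))%N by rewrite subnKC.
move: (n - k)%N => l.
have -> : (((k + l).+2 - k) = l.+2)%N by rewrite -!addnS addKn.
have -> : (((k + l).+1 - k) = l.+1)%N by rewrite -!addnS addKn.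
rewrite addKn subSS addKn !sdomb_coefS /domb_rec_mid /wz_cert -!natr1 natrD.
have := ler0n R k; have := ler0n R l.
move: (k%:R : R) (l%:R : R) (sdomb_coef k) (sdomb_coef l) => a b w y b0 a0.
by field; solve_pos_neq0.
Qed.

Lemma sdomb_rec n :
  (n.+1%:R + 1) ^+ 5 * sdomb n.+2 - domb_rec_mid n.+1 * sdomb n.+1
  + 64 * n.+1%:R * sdomb n = 0.
Proof.
have := sdomb_telescope (leqnn n.+1).
rewrite !big_split /= sumrN -!mulr_sumr -/(sdomb n) subnn.
rewrite /sdomb (big_ord_recr n.+2) (big_ord_recr n.+1) /=.
rewrite (big_ord_recr n.+1) /=.
rewrite subnn subSnn subnn.
set A := \sum_(i < n.+1) _ ; set B := \sum_(i < n.+1) _.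
set C := \sum_(i < n.+1) _.
move=> E.
(* [A], [B], [C] stop at i = n, as far as the telescoping reaches; the remaining terms i = n+1, n+2
   are restored here and cancel its value. *)
transitivity (((n.+1%:R + 1) ^+ 5 * A - domb_rec_mid n.+1 * B
    + 64 * n.+1%:R * C)
  + (n.+1%:R + 1) ^+ 5
    * (sdomb_coef n.+1 * sdomb_coef 1 + sdomb_coef n.+2 * sdomb_coef 0)
  - domb_rec_mid n.+1 * (sdomb_coef n.+1 * sdomb_coef 0)); first by ring.
rewrite E (sdomb_coefS n.+1) (sdomb_coefS 0) sdomb_coef0.
rewrite /domb_rec_mid /wz_cert -!natr1.
have := ler0n R n; move: (n%:R : R) (sdomb_coef n.+1) => a w a0.
by field; solve_pos_neq0.
Qed.

(** With rising factorials, [p_coef k] = 4^k k! / (1/2)_(k+1)^3 and [q_coef k] = (1/2)_k^3 / (4^k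
    k!). The recursive form exposes the rational ratios to [field]. *)
Fixpoint p_coef k : R :=
  if k is j.+1 then 4 * (j%:R + 1) / (j%:R + 3 / 2) ^+ 3 * p_coef j else 8.

Fixpoint q_coef k : R :=
  if k is j.+1 then (j%:R + 1 / 2) ^+ 3 / (4 * (j%:R + 1)) * q_coef j else 1.

(* R_n(i + n + 1/2) / n!^2, factored so that only [p_coef] depends on [n]. *)
Definition zterm n i : R := p_coef (i + n) * q_coef i.

(** The lengths M, M+1, M+2 make all three sums end at the same half-integer t = M + n + 3/2. At the
    lower end they also match, since R_(n+1) and R_(n+2) vanish at the half-integers they skip. *)
Lemma zsum_part_telescope n M :
  (n.+1%:R + 1) ^+ 5 * (\sum_(i < M) zterm n.+2 i)
  - domb_rec_mid n.+1 * (\sum_(i < M.+1) zterm n.+1 i)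
  + 64 * n.+1%:R * (\sum_(i < M.+2) zterm n i)
  = - wz_cert n.+1 (M%:R + n%:R + 5 / 2) * (M%:R + n%:R + 2) / (M%:R + 1)
    * zterm n.+1 M.
Proof.
elim: M => [|M IH].
  rewrite big_ord0 !big_ord_recr !big_ord0 /= /zterm /= !add0n.
  rewrite /wz_cert /domb_rec_mid -!natr1.
  have := ler0n R n; move: (n%:R : R) (p_coef n) => a y a0.
  by field; solve_pos_neq0.
rewrite (big_ord_recr M) (big_ord_recr M.+1) (big_ord_recr M.+2) /=.
rewrite 3!mulrDr opprD.
transitivity (((n.+1%:R + 1) ^+ 5 * (\sum_(i < M) zterm n.+2 i)
  - domb_rec_mid n.+1 * (\sum_(i < M.+1) zterm n.+1 i)
  + 64 * n.+1%:R * (\sum_(i < M.+2) zterm n i))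
  + ((n.+1%:R + 1) ^+ 5 * zterm n.+2 M - domb_rec_mid n.+1 * zterm n.+1 M.+1
     + 64 * n.+1%:R * zterm n M.+2)); first by ring.
rewrite IH /zterm !addnS !addSn /= /wz_cert /domb_rec_mid -!natr1 !natrD.
have := ler0n R n; have := ler0n R M.
move: (n%:R : R) (M%:R : R) (p_coef (M + n)) (q_coef M) => a b y z b0 a0.
by field; solve_pos_neq0.
Qed.

End Recurrence.

(** * Size estimates *)

Section Estimates.
Variable R : realFieldType.
Implicit Types (n k i M : nat) (t : R).

Lemma p_coef_gt0 k : 0 < p_coef R k.
Proof.
elim: k => [|k IH] /=; first by lra.
have k0 := ler0n R k.
by rewrite mulr_gt0 // divr_gt0 ?exprn_gt0 //; lra.
Qed.

Lemma q_coef_gt0 k : 0 < q_coef R k.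
Proof.
elim: k => [|k IH] /=; first by lra.
have k0 := ler0n R k.
by rewrite mulr_gt0 // divr_gt0 ?exprn_gt0 //; lra.
Qed.

Lemma zterm_gt0 n i : 0 < zterm R n i.
Proof. by rewrite mulr_gt0 ?p_coef_gt0 ?q_coef_gt0. Qed.

Lemma zterm0E i : zterm R 0 i = (i%:R + 1 / 2) ^- 3.
Proof.
rewrite /zterm addn0; elim: i => [|i IH] /=; first by rewrite add0r; field.
have -> : forall a b : R, a * p_coef R i * (b * q_coef R i)
    = a * b * (p_coef R i * q_coef R i).
  by move=> a b; ring.
rewrite IH -[in RHS]natr1; have := ler0n R i; move: (i%:R : R) => a a0.
by field; solve_pos_neq0.
Qed.

(** With a = i + 1/2, partial fractions give [zterm 1 i] = 2/a^3 + 2/(a+1)^3 - 2/a^2 + 2/(a+1)^2.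
    The constant 24 = 2*8 + 2*4 is the boundary contribution at a = 1/2. *)
Lemma zsum_part1E M :
  \sum_(i < M) zterm R 1 i = 4 * (\sum_(i < M) zterm R 0 i) - 24
    + 2 * (M%:R + 1 / 2) ^- 2 + 2 * (M%:R + 1 / 2) ^- 3.
Proof.
elim: M => [|M IH]; first by rewrite !big_ord0 add0r; field.
rewrite !big_ord_recr /= IH mulrDr.
have -> : zterm R 1 M = 4 * (M%:R + 1) / (M%:R + 3 / 2) ^+ 3 * zterm R 0 M.
  by rewrite /zterm addn1 addn0 /= mulrA.
rewrite zterm0E -[M.+1%:R]natr1; have := ler0n R M; move: (M%:R : R) => a a0.
by field; solve_pos_neq0.
Qed.

Lemma ztermS n i :
  zterm R n.+1 i
  = 4 * (i%:R + n%:R + 1) / (i%:R + n%:R + 3 / 2) ^+ 3 * zterm R n i.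
Proof. by rewrite /zterm addnS /= natrD mulrA. Qed.

(** The free [t] serves twice: t = n+1 gives the factorial decay in n, and t = i + 1/2 gives extra
    decay in i. *)
Lemma ztermS_le n i t : 0 < t -> t <= i%:R + n%:R + 1 ->
  zterm R n.+1 i <= 4 / t ^+ 2 * zterm R n i.
Proof.
move=> t0 tle; rewrite ztermS ler_pM2r ?zterm_gt0 //.
move: (i%:R + n%:R : R) tle => s tle.
have s0 : 0 < s + 1 by exact: lt_le_trans tle.
apply: (@le_trans _ _ (4 / (s + 1) ^+ 2)).
  rewrite -mulrA ler_pM2l ?ler_pdivrMr ?exprn_gt0; try lra.
  rewrite ler_pdivlMl ?exprn_gt0 // -exprSr lerXn2r ?nnegrE; lra.
rewrite ler_pM2l; last by lra.
by rewrite lef_pV2 ?posrE ?exprn_gt0 // lerXn2r ?nnegrE; lra.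
Qed.

Lemma zterm_le_fact n i : zterm R n i <= 4 ^+ n / (n`!%:R) ^+ 2 * zterm R 0 i.
Proof.
elim: n => [|n IH]; first by rewrite expr0 fact0 expr1n divr1 mul1r.
have n1 : 0 < n%:R + 1 :> R by rewrite natr1 ltr0n.
apply: (le_trans (@ztermS_le n i (n%:R + 1) n1 _)).
  by have := ler0n R i; lra.
apply: (le_trans (ler_wpM2l _ IH)).
  by rewrite divr_ge0 ?exprn_ge0 //; lra.
rewrite factS natrM -[n.+1%:R]natr1 mulrA ler_pM2r ?zterm_gt0 //.
have f0 : (n`!%:R : R) != 0 by rewrite pnatr_eq0 -lt0n fact_gt0.
rewrite le_eqVlt; apply/orP; left; apply/eqP.
by rewrite (exprS 4); field; rewrite f0 lt0r_neq0.
Qed.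

(** Cubic decay in i would only balance the cubic growth of [wz_cert]; order 5 makes the telescoping
    remainder vanish. *)
Lemma ztermS_le_pow n i : zterm R n.+1 i <= 4 ^+ n.+1 * (i%:R + 1 / 2) ^- 5.
Proof.
have i0 := ler0n R i; have n0 := ler0n R n.
have i1 : 0 < i%:R + 1 / 2 :> R by lra.
apply: (le_trans (@ztermS_le n i (i%:R + 1 / 2) i1 _)); first by lra.
have zterm_le : zterm R n i <= 4 ^+ n * zterm R 0 i.
  apply: (le_trans (zterm_le_fact n i)).
  rewrite ler_pM2r ?zterm_gt0 // ler_piMr ?exprn_ge0 //.
  rewrite invf_le1 ?exprn_gt0 ?ltr0n ?fact_gt0 //.
  by rewrite exprn_ege1 // ler1n fact_gt0.
apply: (le_trans (ler_wpM2l _ zterm_le)).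
  by rewrite divr_ge0 ?exprn_ge0 //; lra.
rewrite zterm0E le_eqVlt; apply/orP; left; apply/eqP.
by rewrite (exprS 4); field; solve_pos_neq0.
Qed.

(** Lower powers of t are bounded by t^3; each constant adds the absolute coefficients of one power
    of n, such as 58 = 8 + 24 + 22 + 4. *)
Lemma wz_cert_le n t : 1 <= t ->
  `|wz_cert n t|
  <= (58 + 142 * n%:R + 104 * n%:R ^+ 2 + 24 * n%:R ^+ 3) * t ^+ 3.
Proof.
move=> t1; have n0 := ler0n R n.
have t2 : t ^+ 2 <= t ^+ 3 by rewrite [leRHS]exprS ler_peMl ?exprn_ge0 //; lra.
have t3 : t <= t ^+ 2 by rewrite expr2 ler_peMl //; lra.
have := mulr_ge0 n0 n0; have := mulr_ge0 n0 (mulr_ge0 n0 n0).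
rewrite /wz_cert; move: (n%:R : R) n0 => a a0 a3 a2.
rewrite ler_norml; apply/andP; split; nra.
Qed.

(** The fourth power comes from bounding M + n + 5/2 (cubed) and M + n + 2 by (n+3)(M+1); 32 = 2^5
    comes from M + 1/2 >= (M+1)/2. *)
Definition remainder_bound n : R :=
  (58 + 142 * n.+1%:R + 104 * n.+1%:R ^+ 2 + 24 * n.+1%:R ^+ 3)
  * (n%:R + 3) ^+ 4 * 4 ^+ n.+1 * 32.

Lemma remainder_le n M :
  `| - wz_cert n.+1 (M%:R + n%:R + 5 / 2) * (M%:R + n%:R + 2) / (M%:R + 1)
     * zterm R n.+1 M| <= remainder_bound n * harmonic M.
Proof.
have n0 := ler0n R n; have M0 := ler0n R M; have n10 := ler0n R n.+1.
set s : R := M%:R + 1; have s0 : 0 < s by rewrite /s; lra.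
have s1 : 1 <= s by rewrite /s; lra.
rewrite 3!normrM normrN.
rewrite (gtr0_norm (zterm_gt0 _ _)) (gtr0_norm (_ : 0 < s^-1)) ?invr_gt0 //.
rewrite (gtr0_norm (_ : 0 < M%:R + n%:R + 2)); last by lra.
set K := 58 + 142 * n.+1%:R + 104 * n.+1%:R ^+ 2 + 24 * n.+1%:R ^+ 3 : R.
have K0 : 0 <= K by rewrite /K !addr_ge0 // mulr_ge0 // exprn_ge0.
have ts : M%:R + n%:R + 5 / 2 <= (n%:R + 3) * s by rewrite /s; nra.
have le1 : `|wz_cert n.+1 (M%:R + n%:R + 5 / 2)| <= K * ((n%:R + 3) * s) ^+ 3.
  apply: (le_trans (wz_cert_le _ _)); first by lra.
  by rewrite ler_wpM2l // lerXn2r ?nnegrE //; nra.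
have le2 : M%:R + n%:R + 2 <= (n%:R + 3) * s by rewrite /s; nra.
have le3 : zterm R n.+1 M <= 4 ^+ n.+1 * (32 * s ^- 5).
  apply: (le_trans (ztermS_le_pow n M)); rewrite ler_wpM2l ?exprn_ge0 //.
  have -> : 32 * s ^- 5 = (s / 2) ^- 5 by field; apply: lt0r_neq0.
  rewrite lef_pV2 ?posrE ?exprn_gt0 ?lerXn2r ?nnegrE //; rewrite /s; lra.
apply: (@le_trans _ _ (K * ((n%:R + 3) * s) ^+ 3 * ((n%:R + 3) * s) / s
    * (4 ^+ n.+1 * (32 * s ^- 5)))).
  apply: ler_pM => //; first by rewrite !mulr_ge0 ?invr_ge0 //; lra.
    by rewrite ltW ?zterm_gt0.
  rewrite ler_pM2r ?invr_gt0 //; apply: ler_pM => //; lra.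
rewrite /remainder_bound /= -/K -[M.+1%:R]natr1 -/s.
have -> : K * ((n%:R + 3) * s) ^+ 3 * ((n%:R + 3) * s) / s
    * (4 ^+ n.+1 * (32 * s ^- 5))
  = K * (n%:R + 3) ^+ 4 * 4 ^+ n.+1 * 32 * (s^-1 * s^-1).
  by field; apply: lt0r_neq0.
apply: ler_wpM2l.
  by rewrite !mulr_ge0 ?exprn_ge0 //; lra.
by rewrite ger_pMr ?invr_gt0 // invf_le1.
Qed.

(** This is the central binomial bound 4^n <= (2n+1) binom(2n,n). *)
Lemma sdomb_coef_fact_ge n :
  4 ^+ n <= sdomb_coef R n * n`!%:R ^+ 2 * (2 * n%:R + 1).
Proof.
elim: n => [|n IH]; first by rewrite sdomb_coef0 fact0; lra.
rewrite sdomb_coefS factS natrM -[n.+1%:R]natr1 (exprS 4); have n0 := ler0n R n.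
have -> : 2 * (2 * n%:R + 1) / (n%:R + 1) ^+ 3 * sdomb_coef R n
    * ((n%:R + 1) * n`!%:R) ^+ 2 * (2 * (n%:R + 1) + 1)
  = sdomb_coef R n * n`!%:R ^+ 2 * (2 * n%:R + 1)
    * (2 * (2 * n%:R + 3) / (n%:R + 1)).
  by field; solve_pos_neq0.
rewrite mulrC; apply: ler_pM; rewrite ?exprn_ge0 //.
by rewrite ler_pdivlMr; lra.
Qed.

Lemma sdomb_gt0 n : 0 < sdomb R n.
Proof.
rewrite /sdomb big_ord_recr /= ltr_wpDl //;
  last by rewrite mulr_gt0 // sdomb_coef_gt0.
by apply: sumr_ge0 => i _; rewrite mulr_ge0 // ltW ?sdomb_coef_gt0.
Qed.

(** Keeping only the summand of index 1 gives D_(n+1) >= 2 (n+1)^2 binom(2n,n). The factor n+1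
    beyond 4^n is what forces J_n / D_n to 0. *)
Lemma sdomb_fact_ge n : n.+1%:R * 4 ^+ n <= sdomb R n.+1 * n.+1`!%:R ^+ 2.
Proof.
have n0 := ler0n R n.
have sdomb_ge : 2 * sdomb_coef R n <= sdomb R n.+1.
  have -> : 2 * sdomb_coef R n = sdomb_coef R 1 * sdomb_coef R n.
    by rewrite (sdomb_coefS R 0) sdomb_coef0; field.
  rewrite /sdomb (bigD1 (inord 1)) //= inordK // subn1 lerDl.
  by apply: sumr_ge0 => i _; rewrite mulr_ge0 // ltW ?sdomb_coef_gt0.
have f0 : 0 < n.+1`!%:R ^+ 2 :> R by rewrite exprn_gt0 // ltr0n fact_gt0.
apply: (le_trans _ (ler_wpM2r (ltW f0) sdomb_ge)).
rewrite factS natrM -[n.+1%:R]natr1; have := sdomb_coef_fact_ge n.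
have g0 : 0 < n`!%:R ^+ 2 :> R by rewrite exprn_gt0 // ltr0n fact_gt0.
rewrite exprMn; have := mulr_gt0 (sdomb_coef_gt0 R n) g0.
move: (n%:R : R) (sdomb_coef R n) (n`!%:R ^+ 2 : R) (4 ^+ n : R) n0
  => a b f e a0 bf0 ef.
have := @ler_wpM2l R (a + 1) _ _ _ ef; nra.
Qed.

Lemma domb_sdomb n : (domb n)%:R = n`!%:R ^+ 2 * sdomb R n.
Proof.
rewrite /domb big_mkord natr_sum /sdomb mulr_sumr.
apply: eq_bigr => -[k /= kn] _.
have fn0 m : (m`!%:R : R) != 0 by rewrite pnatr_eq0 -lt0n fact_gt0.
have central m : ('C(m.*2, m))%:R = (m.*2)`!%:R / m`!%:R ^+ 2 :> R.
  have := @bin_fact m.*2 m; rewrite -{1 3}addnn leq_addr addnK => /(_ isT) <-.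
  by rewrite !natrM; field.
have bin : ('C(n, k))%:R = n`!%:R / (k`!%:R * (n - k)`!%:R) :> R.
  by rewrite -(@bin_fact n k kn) !natrM; field; rewrite !fn0.
rewrite !natrM !central bin /sdomb_coef.
by field; rewrite !fn0.
Qed.

End Estimates.

(** * The zeta side and the Casoratian *)

Section Limits.
Variable R : realType.
Implicit Types (n k i M : nat) (t : R).

Definition zeta3_part M : R := \sum_(i < M) i.+1%:R ^- 3.

(** Telescoping majorant: a^-3 <= 2/a - 2/(a+1) for a >= 1. *)
Lemma zeta3_part_le M : zeta3_part M <= 3 - 2 / M.+1%:R.
Proof.
elim: M => [|M IH]; first by rewrite /zeta3_part big_ord0 divr1; lra.
rewrite /zeta3_part big_ord_recr /=; apply: (le_trans (lerD IH (lexx _))).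
rewrite -[M.+2%:R]natr1; have : 1 <= M.+1%:R :> R by rewrite ler1n.
move: (M.+1%:R : R) => a a1; have a0 : 0 < a by lra.
rewrite -subr_ge0.
have -> : 3 - 2 / (a + 1) - (3 - 2 / a + a ^- 3)
    = (2 * a ^+ 2 - a - 1) / (a ^+ 3 * (a + 1)) by field; solve_pos_neq0.
by rewrite divr_ge0 ?mulr_ge0 ?exprn_ge0 //; nra.
Qed.

Lemma zeta3_cvg : zeta3_part M @[M --> \oo] --> zeta (3 : R).
Proof.
have -> : zeta3_part = series (riemannR 3).
  apply: funext => M; rewrite /series /= big_mkord; apply: eq_bigr => i _.
  by rewrite /riemannR powR_mulrn.
rewrite /zeta; set S := series _.
suff : cvgn S by [].
apply: nondecreasing_is_cvgn.
  by apply/nondecreasing_series => i _ _; rewrite ltW ?riemannR_gt0.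
exists 3 => _ [M _ <-].
rewrite /S /series /= big_mkord.
under eq_bigr do rewrite /riemannR powR_mulrn //.
apply: (le_trans (zeta3_part_le M)).
by rewrite gerBl divr_ge0.
Qed.

Definition zsum_part n M : R := \sum_(i < M) zterm R n i.

(* J_n / n!^2 *)
Definition zsum n : R := limn (zsum_part n).

(* 1 / (i + 1/2)^3 = 8 / (2 i + 1)^3, and the odd terms of [zeta 3] are all the
   terms minus the even ones. *)
Lemma zsum_part0 M : zsum_part 0 M = 8 * zeta3_part M.*2 - zeta3_part M.
Proof.
elim: M => [|M IH].
  by rewrite /zsum_part /zeta3_part !big_ord0 mulr0 subr0.
rewrite doubleS /zsum_part /zeta3_part !big_ord_recr /= -!/(zeta3_part _).
rewrite -/(zsum_part 0 M) IH zterm0E -[M.*2.+2%:R]natr1 -[M.*2.+1%:R]natr1.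
rewrite -[M.+1%:R]natr1 -mul2n natrM.
have := ler0n R M; move: (M%:R : R) => a a0.
by field; solve_pos_neq0.
Qed.

Lemma zsum_part0_cvg : zsum_part 0 M @[M --> \oo] --> 7 * zeta (3 : R).
Proof.
have -> : zsum_part 0 = (fun M => 8 * zeta3_part M.*2 - zeta3_part M).
  by apply: funext => M; rewrite zsum_part0.
have -> : 7 * zeta (3 : R) = 8 * zeta (3 : R) - zeta (3 : R) by ring.
apply: cvgB; last exact: zeta3_cvg.
apply: cvgMr.
apply: (@cvg_comp _ _ _ double zeta3_part _ \oo); last exact: zeta3_cvg.
move=> A [N _ NA]; exists N => // m /= Nm; apply: NA => /=.
by rewrite -addnn (leq_trans Nm) ?leq_addr.
Qed.

Lemma zsum0E : zsum 0 = 7 * zeta (3 : R).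
Proof. exact: (cvg_lim _ zsum_part0_cvg). Qed.

(** Uniform in M: it yields both the convergence of J_n and, in the limit, J_n <= 4^n J_0. *)
Lemma zsum_part_le n M :
  zsum_part n M <= 4 ^+ n / n`!%:R ^+ 2 * zsum 0.
Proof.
apply: (@le_trans _ _ (4 ^+ n / n`!%:R ^+ 2 * zsum_part 0 M)).
  by rewrite /zsum_part mulr_sumr; apply: ler_sum => i _; exact: zterm_le_fact.
rewrite ler_wpM2l ?divr_ge0 ?exprn_ge0 // zsum0E.
rewrite -(cvg_lim _ zsum_part0_cvg) //.
apply: nondecreasing_cvgn_le; last first.
  by apply/cvg_ex; exists (7 * zeta 3); exact: zsum_part0_cvg.
apply/nondecreasing_seqP => m.
by rewrite /zsum_part big_ord_recr /= lerDl ltW ?zterm_gt0.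
Qed.

Lemma zsum_cvg n : zsum_part n M @[M --> \oo] --> zsum n.
Proof.
suff : cvgn (zsum_part n) by [].
apply: nondecreasing_is_cvgn.
  apply/nondecreasing_seqP => M.
  by rewrite /zsum_part big_ord_recr /= lerDl ltW ?zterm_gt0.
by exists (4 ^+ n / n`!%:R ^+ 2 * zsum 0) => _ [M _ <-]; exact: zsum_part_le.
Qed.

Lemma zsum_le n : zsum n <= 4 ^+ n / n`!%:R ^+ 2 * zsum 0.
Proof.
apply: limr_le; first exact: zsum_cvg.
by apply: nearW => M; exact: zsum_part_le.
Qed.

Lemma zsum_ge0 n : 0 <= zsum n.
Proof.
apply: limr_ge; first exact: zsum_cvg.
by apply: nearW => M; apply: sumr_ge0 => i _; rewrite ltW ?zterm_gt0.
Qed.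

Lemma zsum_rec n :
  (n.+1%:R + 1) ^+ 5 * zsum n.+2 - domb_rec_mid R n.+1 * zsum n.+1
  + 64 * n.+1%:R * zsum n = 0.
Proof.
(* The shifts by 1 and 2 match [zsum_part_telescope] and leave the limits unchanged; [E] itself is
   O(1/M). *)
set E := (fun M => (n.+1%:R + 1) ^+ 5 * zsum_part n.+2 M
  - domb_rec_mid R n.+1 * zsum_part n.+1 (M + 1)
  + 64 * n.+1%:R * zsum_part n (M + 2)).
have E_lim : E M @[M --> \oo] --> (n.+1%:R + 1) ^+ 5 * zsum n.+2
    - domb_rec_mid R n.+1 * zsum n.+1 + 64 * n.+1%:R * zsum n.
  apply: cvgD; first apply: cvgB; apply: cvgMr; first exact: zsum_cvg.
    by rewrite (cvg_shiftn 1 (zsum_part n.+1)); exact: zsum_cvg.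
  by rewrite (cvg_shiftn 2 (zsum_part n)); exact: zsum_cvg.
apply: (cvg_unique _ E_lim) => //.
apply: norm_cvg0.
have h : remainder_bound R n * harmonic M @[M --> \oo] --> (0 : R).
  by rewrite -[X in _ --> X](mulr0 (remainder_bound R n)); apply: cvgMr;
    exact: cvg_harmonic.
apply: (@squeeze_cvgr _ _ _ _ (fun=> 0) _ _ _ _ _ h); last exact: cvg_cst.
apply: nearW => M; rewrite normr_ge0 /= /E addn1 addn2 zsum_part_telescope.
exact: remainder_le.
Qed.

Lemma zsum1E : zsum 1 = 4 * zsum 0 - 24.
Proof.
apply: (@cvg_unique _ _ (zsum_part 1 M @[M --> \oo])) => //;
  first exact: zsum_cvg.
have -> : zsum_part 1 = (fun M => 4 * zsum_part 0 M - 24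
    + 2 * (M%:R + 1 / 2) ^- 2 + 2 * (M%:R + 1 / 2) ^- 3).
  by apply: funext => M; exact: zsum_part1E.
have inv0 : (M%:R + 1 / 2)^-1 @[M --> \oo] --> (0 : R).
  have h : 2 * harmonic M @[M --> \oo] --> (0 : R).
    by rewrite -[X in _ --> X](mulr0 2); apply: cvgMr; exact: cvg_harmonic.
  apply: (@squeeze_cvgr _ _ _ _ (fun=> 0) _ _ _ _ _ h); last exact: cvg_cst.
  apply: nearW => M; have M0 := ler0n R M.
  rewrite invr_ge0; apply/andP; split; first by lra.
  rewrite /= -[M.+1%:R]natr1 -[2]invrK -invfM.
  rewrite lef_pV2 ?posrE ?mulr_gt0 ?invr_gt0; lra.
have -> : 4 * zsum 0 - 24
    = 4 * zsum 0 - 24 + 2 * (0 * 0) + 2 * (0 * (0 * 0)) by ring.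
apply: cvgD; first apply: cvgD; first apply: cvgB.
- by apply: cvgMr; exact: zsum_cvg.
- exact: cvg_cst.
- by apply: cvgMr; under eq_fun do rewrite -exprVn expr2; exact: cvgM.
- apply: cvgMr; under eq_fun do rewrite -exprVn exprS expr2.
  by apply: cvgM => //; exact: cvgM.
Qed.

(** The shared recurrence gives (n+2)^5 W_(n+1) = 64 (n+1) W_n. Initially W_0 = 4 J_0 - J_1 = 24, so
    zeta(3) cancels. *)
Lemma casoratian n :
  zsum n * sdomb R n.+1 - zsum n.+1 * sdomb R n
  = 24 * 64 ^+ n / (n.+1`!%:R ^+ 4 * n.+1%:R).
Proof.
elim: n => [|n IH].
  rewrite zsum1E /sdomb !big_ord_recr !big_ord0 /= subnn !subn0.
  rewrite (sdomb_coefS R 0) sdomb_coef0 expr0.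
  by rewrite factS fact0; field.
set W := _ - _.
have n0 := ler0n R n.
have f0 : (n.+1`!%:R : R) != 0 by rewrite pnatr_eq0 -lt0n fact_gt0.
have : (n.+1%:R + 1) ^+ 5 * W
    = 64 * n.+1%:R * (zsum n * sdomb R n.+1 - zsum n.+1 * sdomb R n).
  have := zsum_rec n; have := sdomb_rec R n; rewrite /W.
  move: (zsum n.+2) (zsum n.+1) (zsum n).
  move: (sdomb R n.+2) (sdomb R n.+1) (sdomb R n).
  move: ((n.+1%:R + 1) ^+ 5) (domb_rec_mid R n.+1) (64 * n.+1%:R) => a c d.
  move=> v2 v1 v0 x2 x1 x0 Hv Hx.
  (* Cross-multiplying the two recurrences eliminates the middle coefficient [c]. *)
  have -> : a * (x1 * v2 - x2 * v1) = x1 * (a * v2 - c * v1 + d * v0)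
    - v1 * (a * x2 - c * x1 + d * x0) + d * (x0 * v1 - x1 * v0) by ring.
  by rewrite Hv Hx; ring.
rewrite IH (factS n.+1) natrM -[n.+2%:R]natr1 -[n.+1%:R]natr1 (exprS 64 n).
move: W (n.+1`!%:R : R) f0 (n%:R : R) n0 => W f f0 a a0 H.
have a2 : (a + 1 + 1) ^+ 5 != 0 by apply: lt0r_neq0; rewrite exprn_gt0; lra.
apply: (mulfI a2); rewrite {}H {IH}.
by field; rewrite f0 /=; solve_pos_neq0.
Qed.

Lemma zsum_over_sdomb_cvg : zsum n / sdomb R n @[n --> \oo] --> (0 : R).
Proof.
(* The lower bound on D_n is available at successors; there the quotient is at most 4 J_0 /
   (n+1). *)
rewrite -cvg_shiftS.
have h : 4 * zsum 0 * harmonic n @[n --> \oo] --> (0 : R).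
  by rewrite -[X in _ --> X](mulr0 (4 * zsum 0)); apply: cvgMr;
    exact: cvg_harmonic.
apply: (@squeeze_cvgr _ _ _ _ (fun=> 0) _ _ _ _ _ h); last exact: cvg_cst.
apply: nearW => n; have v0 := sdomb_gt0 R n.+1.
rewrite divr_ge0 ?zsum_ge0 ?(ltW v0) //= ler_pdivrMr //.
have f0 : 0 < n.+1`!%:R ^+ 2 :> R by rewrite exprn_gt0 // ltr0n fact_gt0.
apply: (le_trans (zsum_le _)).
rewrite mulrAC ler_pdivrMr // -[leRHS]mulrA exprS.
have n1 : 0 < n.+1%:R :> R by rewrite ltr0n.
have -> : 4 * 4 ^+ n * zsum 0 = 4 * zsum 0 / n.+1%:R * (n.+1%:R * 4 ^+ n).
  by move: (n.+1%:R : R) n1 => a a0; field; apply: lt0r_neq0.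
apply: ler_wpM2l; last exact: sdomb_fact_ge.
by rewrite divr_ge0 ?(ltW n1) // mulr_ge0 // zsum_ge0.
Qed.

(** By the Casoratian, each summand is 8/3 times the drop of J_n / D_n from n-1 to n. *)
Lemma domb_series N :
  \sum_(1 <= n < N.+1)
     64%:R ^+ n / (n%:R ^+ 3 * (domb n)%:R * (domb n.-1)%:R)
  = 8 / 3 * (zsum 0 - zsum N / sdomb R N).
Proof.
elim: N => [|N IH].
  by rewrite big_nil /sdomb big_ord_recr big_ord0 /= add0r sdomb_coef0
    mulr1 divr1 subrr mulr0.
rewrite big_nat_recr //= IH !domb_sdomb.
have f0 : (N`!%:R : R) != 0 by rewrite pnatr_eq0 -lt0n fact_gt0.
have v0 := lt0r_neq0 (sdomb_gt0 R N); have v1 := lt0r_neq0 (sdomb_gt0 R N.+1).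
have -> : zsum N.+1 / sdomb R N.+1 = zsum N / sdomb R N
    - (zsum N * sdomb R N.+1 - zsum N.+1 * sdomb R N)
      / (sdomb R N * sdomb R N.+1).
  by field; rewrite ?v0 ?v1.
rewrite casoratian factS natrM (exprS 64 N).
rewrite -[N.+1%:R]natr1.
by field; rewrite f0 v0 v1 natr1 pnatr_eq0.
Qed.

End Limits.

Theorem theorem1p2 (R : realType) :
  (fun N : nat => \sum_(1 <= n < N)
     64%:R ^+ n / (n%:R ^+ 3 * (domb n)%:R * (domb n.-1)%:R) : R)
    @ \oo --> (56%:R / 3%:R * zeta (3%:R : R) : R).
Proof.
(* Shifting N turns the strict upper bound into the range of [domb_series]. *)
rewrite -cvg_shiftS /=.
under eq_fun do rewrite domb_series.
have -> : 56 / 3 * zeta (3 : R) = 8 / 3 * (zsum R 0 - 0).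
  by rewrite zsum0E; field.
by apply: cvgMr; apply: cvgB; [exact: cvg_cst | exact: zsum_over_sdomb_cvg].
Qed.
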